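(* Let $d\in\mathbb{R}$, let $f$ be a majority-type update function with parameters $m,\beta,\gamma$, and let $Z\stackrel{d}{=}\mathcal{N}\big(d,\tfrac{1}{4(\gamma^2-1)}\big)$. Let $x,y\in[0,1)$ and $H\stackrel{d}{=}\lfloor h(x-\log_\gamma|Z|)+y\rfloor$, where $h(z)=g(z)+z$. Then, as $t\to\infty$, $$\mathbb{P}(H\ge t)=\Theta(\gamma^{-t})\quad\text{and}\quad \mathbb{P}(H\le -t)=\exp\big(\Theta(-\gamma^{2t})\big).$$
   Context: Majority-type update function: a function $f:[0,1]\to[0,1]$ such that (i) $f$ is $(m+1)$-times continuously differentiable for some integer $m\ge 2$; (ii) $f$ is convex on $[0,1/2]$; (iii) $1-f(1-x)=f(x)$ for all $x\in[0,1]$; (iv) there exist $\gamma>1$ and $\beta>0$ such that, as $x\to0$, $f(x)=\beta x^m+O(x^{m+1})$ and $f(1/2+x)=1/2+\gamma x+O(x^2)$. The numbers $m,\beta,\gamma$ are called its parameters. Iterates: $f^{(0)}(x)=x$, $f^{(i)}=f\circ f^{(i-1)}$ for $i\ge1$. The function $g:\mathbb{R}\to\mathbb{R}$ associated with $f$ is $$g(x)=1-x+\lim_{a\to\infty,\,a\in\mathbb{N}}\ \lim_{b\to\infty,\,b\in\mathbb{N}}\Big(b-a-\log_m\big|\ln f^{(b)}(1/2-\gamma^{-a-x})\big|\Big)$$ (these limits exist; for given $x$ only $a$ large enough that $1/2-\gamma^{-a-x}>0$ matter). $\mathcal{N}(\mu,\sigma^2)$ is the Gaussian distribution with mean $\mu$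 and variance $\sigma^2$. $\exp(\Theta(-\gamma^{2t}))$ denotes a quantity lying between $e^{-c_1\gamma^{2t}}$ and $e^{-c_2\gamma^{2t}}$ for some constants $c_1\ge c_2>0$ and all large $t$. *)

(* Defs.v *)
From mathcomp Require Import all_boot all_order all_algebra.
From mathcomp Require Import all_classical all_reals all_analysis.

Set Implicit Arguments.
Unset Strict Implicit.
Unset Printing Implicit Defensive.

Import Order.TTheory GRing.Theory Num.Theory.
Import numFieldNormedType.Exports.

Local Open Scope classical_set_scope.
Local Open Scope ring_scope.

(** The library's derivatives are two-sided; [df] is the derivative of [f]
    relative to [D] (one-sided at the endpoints when [D] is an interval). *)
Definition is_derive_within (R : realType) (D : set R) (f df : R -> R) : Prop :=
  forall x, D x -> (f y - f x) / (y - x) @[y --> within D x^'] --> df x.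

(** [F i] is the [i]-th derivative of [f] on [D]. *)
Definition continuously_differentiable (R : realType) (D : set R) (k : nat)
    (f : R -> R) : Prop :=
  exists F : nat -> R -> R,
    [/\ {in D, F 0%N =1 f},
        forall i, (i < k)%N -> is_derive_within D (F i) (F i.+1)
      & {within D, continuous (F k)}].

(** A map [0, 1] -> [0, 1] is a function [R -> R] of which only the values on
    [0, 1] are constrained; accordingly "x -> 0" means x -> 0+ in
    [majority_near0]. *)
Record majority_type (R : realType) (f : R -> R) (m : nat) (beta gamma : R)
    : Prop := MajorityType {
  majority_range : forall x, x \in `[0, 1] -> f x \in `[0, 1];
  majority_m_ge2 : (2 <= m)%N;
  majority_smooth : continuously_differentiable `[0, 1] m.+1 f;
  majority_convex : convex_function (`[0, 2^-1]%classic : set R^o) f;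
  majority_symmetric : forall x, x \in `[0, 1] -> 1 - f (1 - x) = f x;
  majority_gamma_gt1 : 1 < gamma;
  majority_beta_gt0 : 0 < beta;
  majority_near0 :
    (fun x => f x - beta * x ^+ m) =O_ (0^'+) (fun x => x ^+ m.+1);
  majority_near_half :
    (fun x => f (2^-1 + x) - (2^-1 + gamma * x)) =O_ (nbhs (0 : R))
      (fun x => x ^+ 2) }.

Definition log_base (R : realType) (b x : R) : R := ln x / ln b.

(** For finitely many [a] the argument of [iter b f] can be nonpositive; such
    [a] do not affect the outer limit. *)
Definition majority_g (R : realType) (f : R -> R) (m : nat) (gamma x : R) : R :=
  1 - x +
  lim ((fun a : nat =>
    lim ((fun b : nat =>
      b%:R - a%:R
      - log_base m%:R `|ln (iter b f (2^-1 - gamma `^ (- a%:R - x)))|)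
      @ \oo)) @ \oo).

Definition majority_h (R : realType) (f : R -> R) (m : nat) (gamma z : R) : R :=
  majority_g f m gamma z + z.

(** [p t = exp(Theta(- e t))] as [t] tends to infinity. *)
Definition exp_Theta_opp (R : realType) (p e : R -> R) : Prop :=
  exists c1 c2 : R, [/\ 0 < c2, c2 <= c1 &
    \forall t \near +oo, expR (- c1 * e t) <= p t <= expR (- c2 * e t)].

(* Main.v *)
Require Import Defs.
From mathcomp Require Import all_boot all_order all_algebra.
From mathcomp Require Import all_classical all_reals all_analysis.
From mathcomp Require Import measurable_realfun.
From mathcomp Require Import ring lra.

Set Implicit Arguments.
Unset Strict Implicit.
Unset Printing Implicit Defensive.

Import Order.TTheory GRing.Theory Num.Theory.
Import numFieldNormedType.Exports.

Local Open Scope classical_set_scope.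
Local Open Scope ring_scope.

(** Everything rests on one fact about [h = majority_h f m gamma]: it stays
    within a bounded distance of the identity ([majority_h_near_id]).  Granted
    this, [floor (h (x - log_gamma |Z|) + y)] differs from [- log_gamma |Z|] by
    a bounded amount ([floor_height_near_log]), so that, up to constant
    factors, [H >= t] means [|Z| <= gamma ^ (- t)] and [H <= - t] means
    [|Z| >= gamma ^ t].  A Gaussian has a bounded density that is positive near
    0, which gives the first event a probability of order [gamma ^ (- t)]
    ([normal_ball_Theta]); its tail decays like the exponential of minus the
    square, which gives the second one [exp (Theta (- gamma ^ (2 t)))]
    ([normal_tail_exp_Theta]).

    The double limit in the definition of [h] has to be shown to exist.
    The inner one is a property of the super-attracting fixed point 0: since
    [f s] is of order [s ^ m], [L_b = - ln (f^(b) s)] satisfies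
    [L_(b+1) = m L_b + O(1)], and [L_b] is unbounded, so [L_b / m ^ b] has a
    positive limit ([affine_recursion_cvg]).  This defines the function
    [escape_rate], monotone in [s], which [f] lowers by exactly 1.  The outer
    limit is a property of the repelling fixed point 1/2.  Convexity says that
    [f] enlarges the distance to 1/2 by a factor of at most [gamma]
    ([majority_half_gap_le]); as the starting distances [gamma ^ (- a - z)]
    shrink by exactly that factor, the sequence in [a] is nondecreasing.  It is
    bounded because the second-order expansion at 1/2 lets [f] be compared with
    a Moebius map, whose iterates are explicit
    ([majority_iter_half_gap_inv_le]): after [a] steps the distance is bounded
    below uniformly in [a].

    Replacing [z] by [z + 1] merely reindexes the outer sequence, so
    [h (z + 1) = h z + 1]; as [h] is also nondecreasing, [h z - z] is
    bounded. *)

(** * The update function on [0, 1/2] *)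

Lemma convex_chord (R : realType) (f : R -> R) (D : set R^o) (a b c : R) :
  convex_function D f -> D a -> D c -> a <= b <= c ->
  (c - a) * f b <= (c - b) * f a + (b - a) * f c.
Proof.
move=> cf Da Dc /andP[ab bc].
have [|ac] := eqVneq a c.
  move=> ?; subst c; have -> : b = a by apply/eqP; rewrite eq_le bc.
  by rewrite subrr !mul0r addr0.
have ca : 0 < c - a by rewrite subr_gt0 lt_neqAle ac (le_trans ab bc).
have t0 : 0 <= (c - b) / (c - a).
  by rewrite divr_ge0 // subr_ge0 // ltW // -subr_gt0.
have t1 : (c - b) / (c - a) <= 1 by rewrite ler_pdivrMr // mul1r lerD2l lerN2.
have ha : a \in D by rewrite inE.
have hc : c \in D by rewrite inE.
have : f ((c - b) / (c - a) * a + (1 - (c - b) / (c - a)) * c) <=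
       (c - b) / (c - a) * f a + (1 - (c - b) / (c - a)) * f c.
  exact: (cf (Itv01 t0 t1) a c ha hc).
have -> : (c - b) / (c - a) * a + (1 - (c - b) / (c - a)) * c = b.
  by field; rewrite gt_eqF.
move: (f a : R) (f b : R) (f c : R) => fa fb fc.
rewrite -(ler_pM2l ca) => /le_trans; apply; rewrite le_eqVlt; apply/orP; left.
by apply/eqP; field; rewrite gt_eqF.
Qed.

Section update_function.
Variables (R : realType) (f : R -> R) (m : nat) (beta gamma : R).
Hypothesis hf : majority_type f m beta gamma.
Implicit Types (s r e : R).

Let chord (a b c : R) : 0 <= a -> a <= b -> b <= c -> c <= 2^-1 ->
  (c - a) * f b <= (c - b) * f a + (b - a) * f c.
Proof.
move=> a0 ab bc c1; apply: (convex_chord (majority_convex hf)).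
- by rewrite /= in_itv /= a0 (le_trans ab (le_trans bc c1)).
- by rewrite /= in_itv /= c1 (le_trans a0 (le_trans ab bc)).
- by rewrite ab.
Qed.

Let unit_range s : 0 <= s <= 1 -> 0 <= f s <= 1.
Proof.
by move=> s01; have := majority_range hf (x := s); rewrite !in_itv /=; exact.
Qed.

Lemma majority_near0_power_bounds : exists2 c : R, 0 < c &
  \forall s \near 0^'+, c * s ^+ m <= f s <= c^-1 * s ^+ m.
Proof.
have b0 := majority_beta_gt0 hf.
have /eqOP h := majority_near0 hf.
have [k [kr hk]] : exists k : R, 0 < k /\
    \forall x \near 0^'+, `|f x - beta * x ^+ m| <= k * `|x ^+ m.+1|.
  near (pinfty_nbhs R) => k.
  exists k; split; first by near: k; exact: nbhs_pinfty_gt.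
  by near: k; exact: h.
have c0 : 0 < Num.min (beta / 2) (2 * beta)^-1.
  by rewrite lt_min divr_gt0 // invr_gt0 mulr_gt0.
exists (Num.min (beta / 2) (2 * beta)^-1) => //.
near=> s.
have s0 : 0 < s by near: s; exact: nbhs_right_gt.
have sm : 0 < s ^+ m by rewrite exprn_gt0.
have ks : k * s <= beta / 2.
  rewrite mulrC -ler_pdivlMr //; near: s; apply: nbhs_right_le.
  by rewrite !divr_gt0.
have : `|f s - beta * s ^+ m| <= k * `|s ^+ m.+1| by near: s.
rewrite (@gtr0_norm _ (s ^+ m.+1)) ?exprn_gt0 // exprS mulrA ler_norml.
move=> /andP[h1 h2].
have h3 : k * s * s ^+ m <= beta / 2 * s ^+ m by rewrite ler_pM2r.
have h4 : Num.min (beta / 2) (2 * beta)^-1 * s ^+ m <= beta / 2 * s ^+ m.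
  by rewrite ler_pM2r // ge_min lexx.
have h5 : 2 * beta * s ^+ m <= (Num.min (beta / 2) (2 * beta)^-1)^-1 * s ^+ m.
  rewrite ler_pM2r // -[leLHS]invrK lef_pV2 ?posrE ?invr_gt0 ?mulr_gt0 //.
  by rewrite ge_min lexx orbT.
have h6 : 0 <= beta * s ^+ m by rewrite mulr_ge0 // ltW.
apply/andP; split; first lra.
by apply: le_trans h5; lra.
Unshelve. all: by end_near. Qed.

(** A convex function vanishing at 0 has nondecreasing slope [f s / s].  That
    [f] vanishes at 0 is replaced by its limit at 0+: the chord inequality is
    used on [u, r] and [u] tends to 0. *)
Lemma majority_star_shaped s r : 0 < s -> s <= r -> r <= 2^-1 ->
  r * f s <= s * f r.
Proof.
move=> s0 sr r2; have r0 : 0 < r by exact: lt_le_trans sr.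
have [c c0 hc] := majority_near0_power_bounds.
have m2 := majority_m_ge2 hf.
have /andP[fr _] : 0 <= f r <= 1 by apply: unit_range; rewrite (ltW r0) /=; lra.
apply/ler_addgt0Pr => e e0.
near (0 : R)^'+ => u.
have u0 : 0 < u by near: u; exact: nbhs_right_gt.
have us : u <= s by near: u; exact: nbhs_right_le.
have u1 : u <= 1 by lra.
have /andP[_ fu] : c * u ^+ m <= f u <= c^-1 * u ^+ m by near: u.
have um : u ^+ m <= u.
  by rewrite -[leRHS]expr1 ler_wiXn2l ?(ltW u0) // ltnW.
have uc : u <= c * (e / 2).
  by near: u; apply: nbhs_right_le; rewrite mulr_gt0 // divr_gt0.
have ue : u <= e / 2 by near: u; apply: nbhs_right_le; rewrite divr_gt0.
have fue : f u <= e / 2.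
  by apply: le_trans fu _; rewrite ler_pdivrMl //; exact: le_trans um uc.
have /andP[fu0 _] : 0 <= f u <= 1 by apply: unit_range; rewrite (ltW u0).
have /andP[fs0 fs1] : 0 <= f s <= 1.
  by apply: unit_range; rewrite (ltW s0) /=; lra.
have ch := chord (ltW u0) us sr r2.
have h1 : u * f s <= u by rewrite ler_piMr // ltW.
have h2 : (r - s) * f u <= f u by rewrite ler_piMl //; lra.
have h3 : 0 <= u * f r by rewrite mulr_ge0 // ltW.
move: ch h1 h2 h3; move: (f s) (f r) (f u) fue => fs' fr' fu' fue; nra.
Unshelve. all: by end_near. Qed.

Lemma majority_gt0 s : 0 < s -> s <= 2^-1 -> 0 < f s.
Proof.
move=> s0 s2; have [c c0 hc] := majority_near0_power_bounds.
near (0 : R)^'+ => u.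
have u0 : 0 < u by near: u; exact: nbhs_right_gt.
have us : u <= s by near: u; exact: nbhs_right_le.
have /andP[fu _] : c * u ^+ m <= f u <= c^-1 * u ^+ m by near: u.
have fu0 : 0 < f u by rewrite (lt_le_trans _ fu) // mulr_gt0 ?exprn_gt0.
have := majority_star_shaped u0 us s2.
by rewrite -(pmulr_rgt0 _ u0); apply: lt_le_trans; rewrite mulr_gt0.
Unshelve. all: by end_near. Qed.

Lemma majority_nondecreasing s r : 0 < s -> s <= r -> r <= 2^-1 -> f s <= f r.
Proof.
move=> s0 sr r2; have r0 := lt_le_trans s0 sr.
rewrite -(ler_pM2l r0); apply: le_trans (majority_star_shaped s0 sr r2) _.
by rewrite ler_pM2r // majority_gt0.
Qed.

(** The expansion at 0 only controls a right neighbourhood of 0, but away from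
    0 both sides are bounded between positive constants. *)
Lemma majority_power_bounds : exists2 c : R, 0 < c &
  forall s, 0 < s -> s <= 2^-1 -> c * s ^+ m <= f s <= c^-1 * s ^+ m.
Proof.
have [c c0 hc] := majority_near0_power_bounds.
have [u [u0 u2 hu]] : exists u : R, [/\ 0 < u, u <= 2^-1 &
    forall s, 0 < s -> s <= u -> c * s ^+ m <= f s <= c^-1 * s ^+ m].
  have [e /= e0 he] := hc.
  exists (Num.min (e / 2) 2^-1); split.
  - by rewrite lt_min divr_gt0 /=.
  - by rewrite ge_min lexx orbT.
  - move=> s s0; rewrite le_min => /andP[se _]; apply: he => //=.
    by rewrite sub0r normrN gtr0_norm //; lra.
have um : 0 < u ^+ m by rewrite exprn_gt0.
have u1 : u ^+ m <= 1 by rewrite exprn_ile1 // ?ltW //; lra.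
have cu0 : 0 < c * u ^+ m by rewrite mulr_gt0.
exists (c * u ^+ m) => // s s0 s2.
have sm : 0 < s ^+ m by rewrite exprn_gt0.
have [su|/ltW us] := leP s u.
  have /andP[h1 h2] := hu _ s0 su; apply/andP; split.
    by apply: le_trans h1; rewrite ler_pM2r // ler_piMr // ltW.
  apply: le_trans h2 _.
  by rewrite ler_pM2r // lef_pV2 ?posrE // ler_piMr // ltW.
have /andP[h1 h2] := hu _ u0 (lexx u).
(* Both bounds hold at [u], which forces [c <= c^-1]. *)
have c1 : c <= 1.
  have := le_trans h1 h2; rewrite ler_pM2r // -(ler_pM2l c0) divff ?gt_eqF //.
  by rewrite -expr2 expr_le1 // ltW.
have s1 : s ^+ m <= 1 by rewrite exprn_ile1 // ?ltW //; lra.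
have /andP[_ fs1] : 0 <= f s <= 1.
  by apply: unit_range; rewrite (ltW s0) /=; lra.
have fus := majority_nondecreasing u0 us s2.
apply/andP; split.
  by rewrite (le_trans _ fus) // (le_trans _ h1) // ler_piMr // ltW.
have usm : u ^+ m <= s ^+ m by rewrite lerXn2r // nnegrE ltW.
rewrite (le_trans fs1) // ler_pdivlMl // mulr1 (le_trans _ usm) //.
by rewrite ler_piMl // ltW.
Qed.

Lemma majority_half : f 2^-1 = 2^-1.
Proof.
have := majority_symmetric hf (x := 2^-1); rewrite in_itv /=.
have -> : 1 - 2^-1 = 2^-1 :> R by lra.
by move=> h; have := h ltac:(lra); lra.
Qed.

Lemma majority_near_half_bounds : exists2 k : R, 0 < k & exists2 u : R, 0 < u &
  forall e, 0 < e -> e <= u ->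
    gamma * e - k * e ^+ 2 <= 2^-1 - f (2^-1 - e) <= gamma * e + k * e ^+ 2.
Proof.
have /eqOP h := majority_near_half hf.
have [k k0 hk] : exists2 k : R, 0 < k & \forall x \near (0 : R),
    `|f (2^-1 + x) - (2^-1 + gamma * x)| <= k * `|x ^+ 2|.
  near (pinfty_nbhs R) => k.
  exists k; first by near: k; exact: nbhs_pinfty_gt.
  by near: k; exact: h.
exists k => //; have [u /= u0 hu] := hk.
exists (u / 2); first by rewrite divr_gt0.
move=> e e0 eu; have := hu (- e); rewrite /= sub0r opprK gtr0_norm //.
move=> /(_ ltac:(lra)).
rewrite sqrrN (@ger0_norm _ (e ^+ 2)) ?sqr_ge0 // ler_norml.
by move=> /andP[h1 h2]; apply/andP; split; lra.
Unshelve. all: by end_near. Qed.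

(** The slope of the chords ending at 1/2 increases to [gamma] as they shrink,
    by convexity, so it is at most [gamma]. *)
Lemma majority_half_gap_le e : 0 < e -> e < 2^-1 ->
  2^-1 - f (2^-1 - e) <= gamma * e.
Proof.
move=> e0 e2; have [k k0 [u u0 hu]] := majority_near_half_bounds.
have g1 := majority_gamma_gt1 hf.
apply/ler_addgt0Pr => d d0.
near (0 : R)^'+ => n.
have n0 : 0 < n by near: n; exact: nbhs_right_gt.
have nu : n <= u by near: n; exact: nbhs_right_le.
have ne : n <= e by near: n; exact: nbhs_right_le.
have nd : n <= d / (k * e).
  by near: n; apply: nbhs_right_le; rewrite divr_gt0 // mulr_gt0.
have /andP[_ h2] := hu _ n0 nu.
have := @chord (2^-1 - e) (2^-1 - n) 2^-1
  ltac:(lra) ltac:(lra) ltac:(lra) (lexx _).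
rewrite majority_half; move: nd; rewrite ler_pdivlMr ?mulr_gt0 // => nd h3.
rewrite -(ler_pM2l n0).
have h4 : e * (2^-1 - f (2^-1 - n)) <= e * (gamma * n + k * n ^+ 2).
  by rewrite ler_pM2l.
have h5 : n * (n * (k * e)) <= n * d by rewrite ler_pM2l.
by move: h3 h4 h5; move: (f _) (f _) => p q h3 h4 h5; lra.
Unshelve. all: by end_near. Qed.

Lemma majority_le s : 0 < s -> s <= 2^-1 -> f s <= s.
Proof.
move=> s0 s2; have := majority_star_shaped s0 s2 (lexx _).
rewrite majority_half.
by rewrite mulrC ler_pM2r // invr_gt0.
Qed.

(** In terms of the gap [e] to 1/2, [f] dominates the Moebius map
    [e |-> gamma e / (1 + K e)].  Near 1/2 this follows from the second-order
    expansion; a Moebius map is chosen as minorant, rather than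
    [gamma e - k e ^ 2], because its iterates are explicit and because a large
    [K] makes the bound trivial on the rest of [(0, 1/2)]. *)
Lemma majority_half_gap_ge : exists2 K : R, 0 < K &
  forall e, 0 < e -> e < 2^-1 ->
  gamma * e <= (2^-1 - f (2^-1 - e)) * (1 + K * e).
Proof.
have [k k0 [u u0 hu]] := majority_near_half_bounds.
have g1 := majority_gamma_gt1 hf.
have g0 : 0 < gamma by lra.
pose v := Num.min u (gamma / (2 * k)).
have v0 : 0 < v by rewrite lt_min u0 divr_gt0 // mulr_gt0.
have kg : 0 < 2 * k / gamma by rewrite divr_gt0 // mulr_gt0.
have gv : 0 < gamma / v by rewrite divr_gt0.
(* The first term of [K] serves the gaps below [v], where the expansion is
   valid and [2 k e <= gamma]; the second one serves the gaps above [v], where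
   [K e >= gamma]. *)
exists (2 * k / gamma + gamma / v); first by rewrite addr_gt0.
move=> e e0 e2.
have ge0 : 0 < (2 * k / gamma + gamma / v) * e by rewrite mulr_gt0 // addr_gt0.
have [ev|ve] := leP e v.
  move: ev; rewrite le_min => /andP[eu]; rewrite ler_pdivlMr ?mulr_gt0 // => ek.
  have /andP[h1 _] := hu _ e0 eu.
  have h2 : (gamma * e - k * e ^+ 2) * (1 + 2 * k / gamma * e) <=
      (2^-1 - f (2^-1 - e)) * (1 + (2 * k / gamma + gamma / v) * e).
    apply: ler_pM => //.
    - by rewrite expr2; nra.
    - by rewrite addr_ge0 // ltW // mulr_gt0.
    - by rewrite lerD2l ler_pM2r // lerDl ltW.
  apply: le_trans h2.
  have -> : (gamma * e - k * e ^+ 2) * (1 + 2 * k / gamma * e) =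
      gamma * e + k * e ^+ 2 * (gamma - 2 * k * e) / gamma.
    by field; rewrite gt_eqF.
  rewrite lerDl divr_ge0 // ?(ltW g0) // mulr_ge0 //; last by lra.
  by rewrite mulr_ge0 ?sqr_ge0 // ltW.
have h1 : e <= 2^-1 - f (2^-1 - e).
  by have := @majority_le (2^-1 - e) ltac:(lra) ltac:(lra); lra.
have h2 : gamma <= (2 * k / gamma + gamma / v) * e.
  rewrite mulrDl; apply: (@le_trans _ _ (gamma / v * e)); last first.
    by rewrite lerDr mulr_ge0 // ltW.
  by rewrite mulrAC ler_pdivlMr // ler_pM2l // ltW.
rewrite mulrC; apply: ler_pM => //; rewrite ?(ltW e0) ?(ltW g0) //; lra.
Qed.

Lemma majority_lt s : 0 < s -> s < 2^-1 -> f s < s.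
Proof.
move=> s0 s2; have [K K0 hK] := majority_half_gap_ge.
have g1 := majority_gamma_gt1 hf.
near (0 : R)^'+ => e.
have e0 : 0 < e by near: e; exact: nbhs_right_gt.
have e2 : e < 2^-1 by near: e; apply: nbhs_right_lt; rewrite invr_gt0.
have es : e <= 2^-1 - s by near: e; apply: nbhs_right_le; rewrite subr_gt0.
have eK : e < (gamma - 1) / K.
  by near: e; apply: nbhs_right_lt; rewrite divr_gt0 // subr_gt0.
have r0 : 0 < 2^-1 - e by lra.
have h1 : f (2^-1 - e) < 2^-1 - e.
  move: eK; rewrite ltr_pdivlMr // => eK.
  have h := hK e e0 e2.
  have : gamma * e < (2^-1 - f (2^-1 - e)) * gamma.
    apply: le_lt_trans h _; rewrite ltr_pM2l; first by lra.
    by have := @majority_le (2^-1 - e) ltac:(lra) ltac:(lra); lra.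
  by rewrite mulrC ltr_pM2r; lra.
have := @majority_star_shaped s (2^-1 - e) s0 ltac:(lra) ltac:(lra).
rewrite -(ltr_pM2l r0) => /le_lt_trans; apply.
by rewrite mulrC ltr_pM2r.
Unshelve. all: by end_near. Qed.

End update_function.

(** * The rate of escape to 0 *)

(** After division by [m ^ b], the errors form a convergent geometric series.
    Accordingly [(L b + D) / m ^ b] is nonincreasing and [(L b - D) / m ^ b]
    nondecreasing; the latter is positive from some index on, which keeps the
    common limit away from 0. *)
Lemma affine_recursion_cvg (R : realType) (L : nat -> R) (m : nat) (D : R) :
  (2 <= m)%N -> 0 <= D -> (forall b, `|L b.+1 - m%:R * L b| <= D) ->
  (exists N, D < L N) ->
  exists2 l : R, 0 < l & L b / m%:R ^+ b @[b --> \oo] --> l.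
Proof.
move=> m2 D0 hL [N hN].
have M2 : (2 : R) <= m%:R by rewrite ler_nat.
have M0 : (0 : R) < m%:R by apply: lt_le_trans M2.
have Mb b : (0 : R) < m%:R ^+ b by rewrite exprn_gt0.
have mD : 2 * D <= m%:R * D by rewrite ler_wpM2r.
pose up b := (L b + D) / m%:R ^+ b.
pose low b := (L b - D) / m%:R ^+ b.
have ni : nonincreasing_seq up.
  apply/nonincreasing_seqP => b; rewrite /up ler_pdivrMr // exprS.
  have /andP[_ h] : - D <= L b.+1 - m%:R * L b <= D by rewrite -ler_norml.
  rewrite mulrCA divfK ?gt_eqF //; move: h mD; lra.
have nd : nondecreasing_seq low.
  apply/nondecreasing_seqP => b; rewrite /low ler_pdivlMr // exprS.
  have /andP[h _] : - D <= L b.+1 - m%:R * L b <= D by rewrite -ler_norml.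
  rewrite mulrCA divfK ?gt_eqF //; move: h mD; lra.
have low_up b : low b <= up b.
  by rewrite /low /up ler_pM2r ?invr_gt0 //; lra.
have lN : 0 < low N by rewrite divr_gt0 // subr_gt0.
have lb b : low N <= up b.
  have [bN|/ltnW Nb] := leqP b N; first exact: le_trans (low_up N) (ni _ _ bN).
  exact: le_trans (nd _ _ Nb) (low_up b).
have cu : cvgn up.
  by apply: nonincreasing_is_cvgn => //; exists (low N) => _ [b _ <-].
exists (limn up).
  by apply: lt_le_trans lN _; apply: limr_ge => //; apply: nearW.
have -> : (fun b => L b / m%:R ^+ b) = (fun b => up b - D * (m%:R^-1) ^+ b).
  by apply/funext => b; rewrite /up exprVn mulrDl addrK.
rewrite -[X in _ --> X]subr0 -[X in _ - X](mulr0 D).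
apply: cvgB => //; apply: cvgMr; apply: cvg_expr.
rewrite normfV gtr0_norm // invf_lt1 //; lra.
Qed.

(** If [- ln (f^(b) s)] is asymptotic to [l m ^ b], this is [- log_m l]. *)
Definition escape_rate (R : realType) (f : R -> R) (m : nat) (s : R) : R :=
  lim ((fun b : nat => b%:R - log_base m%:R `|ln (iter b f s)|) @ \oo).

Section iterates.
Variables (R : realType) (f : R -> R) (m : nat) (beta gamma : R).
Hypothesis hf : majority_type f m beta gamma.
Implicit Types (s r e : R).

Lemma majority_iter_range s b : 0 < s < 2^-1 -> 0 < iter b f s < 2^-1.
Proof.
move=> h; elim: b => //= b /andP[s0 s2].
rewrite (majority_gt0 hf) ?(ltW s2) //=.
by rewrite (le_lt_trans (majority_le hf _ _)) // ltW.
Qed.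

Lemma majority_iter_mono s r b : 0 < s -> s <= r -> r < 2^-1 ->
  iter b f s <= iter b f r.
Proof.
move=> s0 sr r2; elim: b => //= b IH.
have /andP[h1 _] : 0 < iter b f s < 2^-1.
  by apply: majority_iter_range; rewrite s0 (le_lt_trans sr).
have /andP[_ /ltW h2] : 0 < iter b f r < 2^-1.
  by apply: majority_iter_range; rewrite r2 (lt_le_trans s0).
exact: (majority_nondecreasing hf).
Qed.

(** The slope [f r / r] is at most its value at [s] for every [r <= s], and the
    orbit of [s] stays below [s]. *)
Lemma majority_iter_geometric s b : 0 < s < 2^-1 ->
  iter b f s <= (f s / s) ^+ b * s.
Proof.
move=> hs; have /andP[s0 s2] := hs.
elim: b => [|b IH] /=; first by rewrite mul1r.
have /andP[h1 _] := majority_iter_range b hs.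
have hle : iter b f s <= s.
  elim: b {IH h1} => //= b IH; apply: le_trans IH.
  have /andP[h1 h2] := majority_iter_range b hs.
  by rewrite (majority_le hf) // ltW.
have := majority_star_shaped hf h1 hle (ltW s2).
rewrite mulrC -ler_pdivlMr // => h; apply: le_trans h _.
rewrite exprS -!mulrA (mulrC (iter b f s)).
have fs := majority_gt0 hf s0 (ltW s2).
rewrite -mulrA ler_pM2l // ler_pM2l ?invr_gt0 //.
Qed.

Definition neg_log_iter s (b : nat) := - ln (iter b f s).

Let neg_log_iter_gt0 s b : 0 < s < 2^-1 -> 0 < neg_log_iter s b.
Proof.
move=> hs; have /andP[h1 h2] := majority_iter_range b hs.
by rewrite oppr_gt0 ln_lt0 // h1 /=; lra.
Qed.

Lemma neg_log_iter_recursion : exists2 D : R, 0 <= D &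
  forall s b, 0 < s < 2^-1 ->
  `|neg_log_iter s b.+1 - m%:R * neg_log_iter s b| <= D.
Proof.
have [c c0 hc] := majority_power_bounds hf.
exists `|ln c| => // s b hs.
have /andP[h1 h2] := majority_iter_range b hs.
have /andP[h3 h4] := hc _ h1 (ltW h2).
have sm : 0 < iter b f s ^+ m by rewrite exprn_gt0.
have fs := majority_gt0 hf h1 (ltW h2).
have h5 : ln c + m%:R * ln (iter b f s) <= ln (f (iter b f s)).
  rewrite mulrC mulr_natr -lnXn // -lnM ?posrE // ler_ln ?posrE //.
  by rewrite mulr_gt0.
have h6 : ln (f (iter b f s)) <= - ln c + m%:R * ln (iter b f s).
  rewrite -lnV ?posrE // mulrC mulr_natr -lnXn // -lnM ?posrE ?invr_gt0 //.
  by rewrite ler_ln ?posrE // mulr_gt0 // invr_gt0.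
have := ler_norm (ln c); have := ler_norm (- ln c).
rewrite normrN /neg_log_iter /= => h7 h8.
by rewrite ler_norml; apply/andP; split; lra.
Qed.

Lemma neg_log_iter_unbounded s (D : R) : 0 < s < 2^-1 ->
  exists b, D < neg_log_iter s b.
Proof.
move=> hs; have /andP[s0 s2] := hs.
have fs := majority_gt0 hf s0 (ltW s2).
pose q := f s / s.
have q0 : 0 < q by rewrite divr_gt0.
have lq : 0 < - ln q.
  by rewrite oppr_gt0 ln_lt0 // q0 /= ltr_pdivrMr // mul1r (majority_lt hf).
pose b := (Num.truncn (`|D| / - ln q)).+1; exists b.
have /andP[h1 h2] := majority_iter_range b hs.
have h3 : `|D| < b%:R * - ln q by rewrite -ltr_pdivrMr // /b truncnS_gt.
have h4 : ln (iter b f s) <= b%:R * ln q + ln s.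
  rewrite mulrC mulr_natr -lnXn // -lnM ?posrE ?exprn_gt0 //.
  by rewrite ler_ln ?posrE ?mulr_gt0 ?exprn_gt0 // majority_iter_geometric.
have h5 : ln s < 0 by rewrite ln_lt0 // s0 /=; lra.
have := ler_norm D; rewrite /neg_log_iter; lra.
Qed.

(** The sequence is [- log_m (L_b / m ^ b)], with [L_b = neg_log_iter s b], and
    [L_b / m ^ b] has a positive limit. *)
Lemma escape_rate_cvg s : 0 < s < 2^-1 ->
  b%:R - log_base m%:R `|ln (iter b f s)| @[b --> \oo] --> escape_rate f m s.
Proof.
move=> hs; have m2 := majority_m_ge2 hf.
have [D D0 hD] := neg_log_iter_recursion.
have [l l0 hl] := affine_recursion_cvg m2 D0 (fun b => hD s b hs)
  (neg_log_iter_unbounded D hs).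
have M2 : (2 : R) <= m%:R by rewrite ler_nat.
have M0 : (0 : R) < m%:R by apply: lt_le_trans M2.
have lm : 0 < ln (m%:R : R) by rewrite ln_gt0 //; lra.
suff : b%:R - log_base m%:R `|ln (iter b f s)| @[b --> \oo] -->
    - (ln l / ln m%:R) by move/cvgP.
have -> : (fun b : nat => b%:R - log_base m%:R `|ln (iter b f s)|) =
          (fun b : nat => - (ln (neg_log_iter s b / m%:R ^+ b) / ln m%:R)).
  apply/funext => b.
  have Lb := neg_log_iter_gt0 b hs.
  rewrite -normrN -/(neg_log_iter s b) gtr0_norm //.
  rewrite ln_div ?posrE ?exprn_gt0 // lnXn //.
  by rewrite /log_base -mulr_natl; field; rewrite gt_eqF.
apply: cvgN; apply: cvgMl.
apply: (cvg_comp _ _ hl); exact: continuous_ln.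
Qed.

Lemma escape_rate_mono s r : 0 < s -> s <= r -> r < 2^-1 ->
  escape_rate f m s <= escape_rate f m r.
Proof.
move=> s0 sr r2.
have hs : 0 < s < 2^-1 by rewrite s0 (le_lt_trans sr).
have hr : 0 < r < 2^-1 by rewrite r2 (lt_le_trans s0).
have m2 := majority_m_ge2 hf.
have M2 : (2 : R) <= m%:R by rewrite ler_nat.
have lm : 0 < ln (m%:R : R) by rewrite ln_gt0 //; lra.
apply: ler_lim.
- exact: cvgP (escape_rate_cvg hs).
- exact: cvgP (escape_rate_cvg hr).
apply: nearW => b; rewrite lerD2l lerN2 /log_base ler_pM2r ?invr_gt0 //.
have h := majority_iter_mono b s0 sr r2.
have /andP[s1 _] := majority_iter_range b hs.
have /andP[r1 _] := majority_iter_range b hr.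
have := neg_log_iter_gt0 b hs; have := neg_log_iter_gt0 b hr.
rewrite /neg_log_iter !oppr_gt0 => l1 l2.
by rewrite !ltr0_norm // ler_ln ?posrE ?oppr_gt0 // lerN2 ler_ln.
Qed.

Lemma escape_rate_iter s k : 0 < s < 2^-1 ->
  escape_rate f m (iter k f s) = escape_rate f m s - k%:R.
Proof.
move=> hs; apply: cvg_lim => //.
have -> : (fun b : nat => b%:R - log_base m%:R `|ln (iter b f (iter k f s))|) =
  (fun b : nat => ((b + k)%:R - log_base m%:R `|ln (iter (b + k) f s)|) - k%:R).
  by apply/funext => b; rewrite iterD natrD; ring.
apply: cvgB; last exact: cvg_cst.
rewrite (cvg_shiftn k (fun b : nat => b%:R - log_base m%:R `|ln (iter b f s)|)).
exact: escape_rate_cvg.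
Qed.

End iterates.

(** * The limit defining h *)

Section height.
Variables (R : realType) (f : R -> R) (m : nat) (beta gamma : R).
Hypothesis hf : majority_type f m beta gamma.
Implicit Types (s r e z : R).

Let g0 : 0 < gamma. Proof. by have := majority_gamma_gt1 hf; lra. Qed.
Let lg0 : 0 < ln gamma.
Proof. by rewrite ln_gt0 // (majority_gamma_gt1 hf). Qed.

(** In the coordinate [1 / e], where [e] is the gap to 1/2, one step of the
    Moebius minorant is the affine contraction [w |-> (w + K) / gamma], whose
    iterates are bounded by the geometric series. *)
Lemma majority_iter_half_gap_inv_le : exists2 K : R, 0 < K &
  forall e k, 0 < e < 2^-1 ->
  (2^-1 - iter k f (2^-1 - e))^-1 <= (gamma ^+ k * e)^-1 + K.
Proof.
have g1 := majority_gamma_gt1 hf.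
have [K K0 hK] := majority_half_gap_ge hf.
exists (K / (gamma - 1)); first by rewrite divr_gt0 // subr_gt0.
move=> e k he; elim: k => [|k IH] /=.
  by rewrite expr0 mul1r subKr lerDl divr_ge0 ?(ltW K0) // subr_ge0 ltW.
have he' : 0 < 2^-1 - e < 2^-1 by have /andP[] := he; lra.
have /andP[h1 h2] := majority_iter_range hf k he'.
move: IH; set s := iter k f (2^-1 - e) in h1 h2 *.
have p0 : 0 < 2^-1 - s by lra.
have := hK (2^-1 - s) p0 ltac:(lra); rewrite subKr => h3 IH.
have fs2 : 0 < 2^-1 - f s.
  by rewrite subr_gt0 (le_lt_trans (majority_le hf h1 (ltW h2))).
apply: (@le_trans _ _ (((2^-1 - s)^-1 + K) / gamma)).
  rewrite ler_pdivlMr // ler_pdivrMl //.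
  have -> : (2^-1 - s)^-1 + K = (1 + K * (2^-1 - s)) / (2^-1 - s).
    by rewrite mulrDl mul1r mulfK ?gt_eqF.
  by rewrite mulrA ler_pdivlMr.
have -> : (gamma ^+ k.+1 * e)^-1 + K / (gamma - 1) =
    ((gamma ^+ k * e)^-1 + K / (gamma - 1) + K) / gamma.
  have /andP[e0 _] := he.
  rewrite exprS; field.
  by rewrite subr_eq0 !gt_eqF // exprn_gt0.
by rewrite ler_pM2r ?invr_gt0 // lerD2r.
Qed.

(** The distance to 1/2 of the starting point in the definition of [g]. *)
Definition start_gap z (a : nat) : R := gamma `^ (- a%:R - z).

Let start_gap_gt0 z a : 0 < start_gap z a. Proof. exact: powR_gt0. Qed.

Let start_gapS z a : gamma * start_gap z a.+1 = start_gap z a.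
Proof.
rewrite /start_gap -[X in X * _]powRr1 ?(ltW g0) // -powRD; last first.
  by apply/implyP => _; rewrite gt_eqF.
by congr (_ `^ _); rewrite -natr1; ring.
Qed.

Let start_gapX z a : gamma ^+ a * start_gap z a = gamma `^ (- z).
Proof.
elim: a => [|a IH]; first by rewrite mul1r /start_gap oppr0 add0r.
by rewrite exprSr -mulrA start_gapS.
Qed.

Lemma start_gap_lt_half z : exists N, forall a, (N <= a)%N ->
  start_gap z a < 2^-1.
Proof.
exists (Num.truncn `|ln 2 / ln gamma - z|).+1 => a ha.
rewrite -ltr_ln ?posrE ?powR_gt0 ?invr_gt0 // ln_powR lnV ?posrE //.
have h1 : `|ln 2 / ln gamma - z| < a%:R.
  by apply: (lt_le_trans (truncnS_gt _)); rewrite ler_nat.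
have h2 : ln 2 < (a%:R + z) * ln gamma.
  by rewrite -ltr_pdivrMr //; have := ler_norm (ln 2 / ln gamma - z); lra.
lra.
Qed.

(** The inner limit of the definition of [g], once [start_gap z a < 1/2]. *)
Definition level z (a : nat) : R :=
  escape_rate f m (2^-1 - start_gap z a) - a%:R.

(** Starting from the gap [e = start_gap z a.+1], one step of [f] leads to a
    gap of at most [gamma e = start_gap z a], and it lowers [escape_rate]
    by 1. *)
Let level_nondecreasing z a : start_gap z a < 2^-1 -> level z a <= level z a.+1.
Proof.
move=> h; have d1 := start_gap_gt0 z a; have d2 := start_gap_gt0 z a.+1.
have dS := start_gapS z a; have g1 := majority_gamma_gt1 hf.
have d3 : start_gap z a.+1 < start_gap z a by rewrite -dS ltr_pMl.
suff : escape_rate f m (2^-1 - start_gap z a) <=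
    escape_rate f m (2^-1 - start_gap z a.+1) - 1%:R.
  have aS : a.+1%:R = a%:R + 1 :> R by rewrite natr1.
  rewrite /level aS.
  by move: (escape_rate f m _) (escape_rate f m _) => p q; lra.
rewrite -(escape_rate_iter hf 1); last lra.
have fh := majority_half_gap_le hf d2 (lt_trans d3 h).
apply: (escape_rate_mono hf) => /=; try lra.
by rewrite (le_lt_trans (majority_le hf _ _)); lra.
Qed.

(** Boundedness: [level z a] is the [escape_rate] of the [a]-th iterate, and
    that iterate stays at a distance from 1/2 that does not depend on [a]. *)
Let level_cvg z : cvgn (level z).
Proof.
have [N hN] := start_gap_lt_half z.
have [K K0 hK] := majority_iter_half_gap_inv_le.
have nd : nondecreasing_seq (fun n => level z (n + N)).
  apply/nondecreasing_seqP => n; rewrite addSn.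
  exact/level_nondecreasing/hN/leq_addl.
pose c := (gamma `^ z + K)^-1.
have c0 : 0 < c by rewrite invr_gt0 addr_gt0 // powR_gt0.
have : cvgn (fun n => level z (n + N)).
  apply: nondecreasing_is_cvgn nd _.
  exists (escape_rate f m (2^-1 - c)) => _ [n _ <-].
  set a := (n + N)%N.
  have d0 := start_gap_gt0 z a.
  have d2 : start_gap z a < 2^-1 by exact/hN/leq_addl.
  have hd : 0 < start_gap z a < 2^-1 by rewrite d0.
  have hs : 0 < 2^-1 - start_gap z a < 2^-1 by lra.
  have /andP[s0 s2] := majority_iter_range hf a hs.
  rewrite /level -(escape_rate_iter hf) //.
  apply: (escape_rate_mono hf) => //; last by lra.
  have := hK (start_gap z a) a hd; rewrite start_gapX -powRN opprK.
  rewrite -[leRHS]invrK -/c lef_pV2 ?posrE //; lra.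
case/cvg_ex => l; rewrite (cvg_shiftn N (level z)) => hl.
by apply/cvg_ex; exists l.
Qed.

Lemma majority_hE z : majority_h f m gamma z = 1 + limn (level z).
Proof.
rewrite /majority_h /majority_g.
suff -> : lim ((fun a : nat => lim ((fun b : nat =>
    b%:R - a%:R - log_base m%:R `|ln (iter b f (2^-1 - gamma `^ (- a%:R - z)))|)
      @ \oo)) @ \oo) = limn (level z) by ring.
apply: cvg_lim => //.
have hl : level z @ \oo --> limn (level z) by exact: level_cvg.
apply: cvg_trans hl; apply: near_eq_cvg.
have [N hN] := start_gap_lt_half z.
exists N => // a /= Na; apply/esym/cvg_lim => //.
have d0 := start_gap_gt0 z a; have d2 : start_gap z a < 2^-1 by exact: hN.
have hs : 0 < 2^-1 - start_gap z a < 2^-1 by lra.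
have -> : (fun b : nat => b%:R - a%:R -
    log_base m%:R `|ln (iter b f (2^-1 - gamma `^ (- a%:R - z)))|) =
  (fun b : nat =>
    b%:R - log_base m%:R `|ln (iter b f (2^-1 - start_gap z a))| - a%:R).
  by apply/funext => b; rewrite addrAC.
apply: cvgB; last exact: cvg_cst.
exact: (escape_rate_cvg hf hs).
Qed.

Lemma majority_h_shift z :
  majority_h f m gamma (z + 1) = majority_h f m gamma z + 1.
Proof.
rewrite !majority_hE -addrA; congr (1 + _); apply: cvg_lim => //.
have -> : level (z + 1) = fun a => level z (a + 1) + 1.
  apply/funext => a; rewrite /level /start_gap natrD.
  have -> : - a%:R - (z + 1) = - (a%:R + 1) - z by ring.
  by rewrite opprD addrA subrK.
apply: cvgD; last exact: cvg_cst.
rewrite (cvg_shiftn 1 (level z)); exact: level_cvg.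
Qed.

Lemma majority_h_nondecreasing : nondecreasing_fun (majority_h f m gamma).
Proof.
move=> z z' zz; rewrite !majority_hE lerD2l.
apply: ler_lim; [exact: level_cvg|exact: level_cvg|].
have [N hN] := start_gap_lt_half z.
exists N; first by [].
move=> a Na; rewrite /level.
rewrite lerD2r.
have d0 := start_gap_gt0 z' a; have d2 : start_gap z a < 2^-1 by exact: hN.
have dd : start_gap z' a <= start_gap z a.
  by rewrite /start_gap ler_powR ?(ltW (majority_gamma_gt1 hf)) // lerD2l lerN2.
apply: (escape_rate_mono hf); lra.
Qed.

(** By monotonicity and [majority_h_shift], [h z] lies between
    [h 0 + floor z] and [h 0 + floor z + 1]. *)
Lemma majority_h_near_id : exists B : R,
  forall z, `|majority_h f m gamma z - z| <= B.
Proof.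
set h := majority_h f m gamma.
have hn z (n : nat) : h (z + n%:R) = h z + n%:R.
  elim: n z => [|n IH] z; first by rewrite !addr0.
  have nS : n.+1%:R = n%:R + 1 :> R by rewrite natr1.
  by rewrite nS !addrA /h majority_h_shift -/h IH.
have hz z (n : int) : h (z + n%:~R) = h z + n%:~R.
  case: n => n; first exact: hn.
  rewrite NegzE mulrNz; have := hn (z - n.+1%:R) n.+1; rewrite subrK => ->.
  by rewrite addrK.
exists (`|h 0| + 1) => z.
have /andP[z1 z2] := floor_itv z; rewrite intrD in z2.
have h1 : h (Num.floor z)%:~R <= h z by exact: majority_h_nondecreasing.
have h2 : h z <= h ((Num.floor z)%:~R + 1).
  by apply: majority_h_nondecreasing; exact: ltW.
have hfl : h (Num.floor z)%:~R = h 0 + (Num.floor z)%:~R by rewrite -hz add0r.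
rewrite {2}/h majority_h_shift -/h hfl in h2; rewrite hfl in h1.
have := ler_norm (h 0); have := ler_norm (- h 0); rewrite normrN => h3 h4.
move: h1 h2 h3 h4; move: (h z) (h 0) => p q h1 h2 h3 h4.
by rewrite ler_norml; apply/andP; split; lra.
Qed.

End height.

(** * Bounds on Gaussian probabilities *)

Section gaussian_bounds.
Variables (R : realType) (d sigma : R).
Hypothesis s0 : sigma != 0.
Implicit Types (A : set R) (a b r M : R).
Notation mu := (@lebesgue_measure R).

Let var0 : 0 < sigma ^+ 2.
Proof. by rewrite exprn_even_gt0. Qed.

Let pdfE z : normal_pdf d sigma z =
  normal_peak sigma * expR (- (z - d) ^+ 2 / (sigma ^+ 2 *+ 2)).
Proof. by rewrite normal_pdfE. Qed.

Let mpdf A : measurable_fun A (fun z => (normal_pdf d sigma z)%:E).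
Proof.
apply/measurable_EFinP; apply: measurable_funTS; exact: measurable_normal_pdf.
Qed.

Lemma normal_prob_ge A a b M : measurable A -> a <= b -> `[a, b] `<=` A ->
  (forall z, a <= z <= b -> `|z - d| <= M) ->
  (((b - a) * (normal_peak sigma * expR (- M ^+ 2 / (sigma ^+ 2 *+ 2))))%:E
    <= normal_prob d sigma A)%E.
Proof.
move=> mA ab sA hM.
have mI : measurable (`[a, b]%classic : set R) by [].
apply: (@le_trans _ _ (normal_prob d sigma `[a, b]%classic)); last first.
  by apply: le_measure => //; rewrite inE.
set k := normal_peak sigma * _.
have k0 : 0 <= k by rewrite mulr_ge0 ?normal_peak_ge0 ?expR_ge0.
have -> : ((b - a) * k)%:E = (\int[mu]_(z in `[a, b]) cst k%:E z)%E.
  rewrite integral_cst //= lebesgue_measure_itv /= lte_fin.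
  move: ab; rewrite le_eqVlt => /orP[/eqP ->|->].
    by rewrite ltxx mule0 subrr mul0r.
  by rewrite -EFinB -EFinM mulrC.
apply: ge0_le_integral => //.
  exact: mpdf.
move=> z /=; rewrite in_itv /= => hz; rewrite lee_fin pdfE.
rewrite ler_wpM2l ?normal_peak_ge0 // ler_expR.
rewrite ler_pM2r ?invr_gt0 ?mulrn_wgt0 // lerN2.
rewrite -(real_normK (num_real (z - d))) lerXn2r ?nnegrE // ?hM //.
by rewrite (le_trans _ (hM _ hz)).
Qed.

Lemma normal_prob_le A a b : measurable A -> a <= b -> A `<=` `[a, b] ->
  (normal_prob d sigma A <= ((b - a) * normal_peak sigma)%:E)%E.
Proof.
move=> mA ab sA.
have mI : measurable (`[a, b]%classic : set R) by [].
apply: (@le_trans _ _ (normal_prob d sigma `[a, b]%classic)).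
  by apply: le_measure => //; rewrite inE.
have -> : ((b - a) * normal_peak sigma)%:E =
    (\int[mu]_(z in `[a, b]) cst (normal_peak sigma)%:E z)%E.
  rewrite integral_cst //= lebesgue_measure_itv /= lte_fin.
  move: ab; rewrite le_eqVlt => /orP[/eqP ->|->].
    by rewrite ltxx mule0 subrr mul0r.
  by rewrite -EFinB -EFinM mulrC.
apply: ge0_le_integral => //.
- by move=> z _; rewrite lee_fin normal_pdf_ge0.
- exact: mpdf.
- by move=> z _; rewrite lee_fin normal_pdf_ub.
Qed.

(** One half of the quadratic exponent is bounded by its value at distance
    [r - |d|]; the other half integrates to at most 1 as a Gaussian density of
    variance [2 sigma ^ 2], up to the factor [sqrt 2]. *)
Lemma normal_tail_le A r : measurable A -> `|d| <= r ->
  (forall z, A z -> r <= `|z|) ->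
  (normal_prob d sigma A <=
    (Num.sqrt 2 * expR (- (r - `|d|) ^+ 2 / (sigma ^+ 2 *+ 4)))%:E)%E.
Proof.
move=> mA dr hA.
set k := Num.sqrt 2 * _.
have k0 : 0 <= k by rewrite mulr_ge0 ?sqrtr_ge0 ?expR_ge0.
pose tau := Num.sqrt 2 * sigma.
have tau0 : tau != 0 by rewrite mulf_neq0 // sqrtr_eq0 -ltNge.
have tau2 : tau ^+ 2 = 2 * sigma ^+ 2 by rewrite exprMn sqr_sqrtr.
apply: (@le_trans _ _ (k%:E * normal_prob d tau A)%E); last first.
  rewrite -[leRHS]mule1 lee_wpmul2l ?lee_fin //; exact: probability_le1.
rewrite /normal_prob -ge0_integralZl //; last 2 first.
- apply/measurable_EFinP; apply: measurable_funTS; exact: measurable_normal_pdf.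
- by move=> z _; rewrite lee_fin normal_pdf_ge0.
apply: ge0_le_integral => //.
- by move=> z _; rewrite lee_fin normal_pdf_ge0.
- exact: mpdf.
- apply: measurable_funeM; apply/measurable_EFinP; apply: measurable_funTS.
  exact: measurable_normal_pdf.
move=> z Az; rewrite -EFinM lee_fin pdfE normal_pdfE // /k.
have -> : normal_peak sigma = Num.sqrt 2 * normal_peak tau.
  rewrite /normal_peak tau2.
  have -> : 2 * sigma ^+ 2 * pi *+ 2 = 2 * (sigma ^+ 2 * pi *+ 2) by ring.
  by rewrite sqrtrM // invfM mulrA mulfV ?mul1r.
rewrite -!mulrA ler_wpM2l ?sqrtr_ge0 // mulrCA ler_wpM2l ?normal_peak_ge0 //.
rewrite /normal_fun -expRD ler_expR tau2.
have h1 : (r - `|d|) ^+ 2 <= (z - d) ^+ 2.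
  rewrite -(real_normK (num_real (z - d))) lerXn2r ?nnegrE ?subr_ge0 //.
  by rewrite (le_trans _ (lerB_dist _ _)) // lerD2r hA.
have -> : - (z - d) ^+ 2 / (sigma ^+ 2 *+ 2) =
   - (z - d) ^+ 2 / (sigma ^+ 2 *+ 4) + - (z - d) ^+ 2 / (2 * sigma ^+ 2 *+ 2).
  by field.
by rewrite lerD2r ler_pM2r ?invr_gt0 ?mulrn_wgt0 // lerN2.
Qed.

End gaussian_bounds.

Section gaussian_asymptotics.
Variables (R : realType) (d sigma gamma B : R).
Hypotheses (s0 : sigma != 0) (g1 : 1 < gamma).
Implicit Types (t z u : R).

Let g0 : 0 < gamma. Proof. exact: lt_trans g1. Qed.

Let var0 : 0 < sigma ^+ 2.
Proof. by rewrite exprn_even_gt0. Qed.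

Lemma powR_near_pinfty (X : R) : \forall t \near +oo, X <= gamma `^ t.
Proof.
have lg0 : 0 < ln gamma by rewrite ln_gt0.
near=> t.
have tX : X / ln gamma <= t by near: t; apply: nbhs_pinfty_ge; exact: num_real.
rewrite /powR gt_eqF //; apply: le_trans (expR_ge1Dx _).
by move: tX; rewrite ler_pdivrMr // => tX; lra.
Unshelve. all: by end_near. Qed.

Let gD t u : gamma `^ (t + u) = gamma `^ t * gamma `^ u.
Proof. by apply: powRD; rewrite [gamma == 0]gt_eqF ?implybT. Qed.

Let fineP (A : set R) (k : R) : measurable A ->
  (k%:E <= normal_prob d sigma A)%E -> k <= fine (normal_prob d sigma A).
Proof. by move=> mA; rewrite -lee_fin fineK // fin_num_measure. Qed.

Let fineP' (A : set R) (k : R) : measurable A ->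
  (normal_prob d sigma A <= k%:E)%E -> fine (normal_prob d sigma A) <= k.
Proof. by move=> mA; rewrite -lee_fin fineK // fin_num_measure. Qed.

(** The lower bound comes from the interval [[r / 2, r]] with
    [r = gamma ^ (- t - B)]: it is contained in the event, its length is
    proportional to [gamma ^ (- t)], and for [r <= 1] the density on it is
    bounded below by a constant. *)
Lemma normal_ball_Theta (A : R -> set R) :
  (forall t, measurable (A t)) ->
  (forall t z, A t z -> `|z| <= gamma `^ (B - t)) ->
  (forall t z, 0 < z -> z <= gamma `^ (- t - B) -> A t z) ->
  (fun t => fine (normal_prob d sigma (A t))) \is
    'Theta_(pinfty_nbhs R) (fun t => gamma `^ (- t)).
Proof.
move=> mA hup hlow.
have G0 : 0 < gamma `^ B by exact: powR_gt0.
have pk := normal_peak_gt0 s0.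
pose c := normal_peak sigma * expR (- (1 + `|d|) ^+ 2 / (sigma ^+ 2 *+ 2)).
have c0 : 0 < c by rewrite mulr_gt0 // expR_gt0.
apply/asboolP.
exists (c / (2 * gamma `^ B), 2 * gamma `^ B * normal_peak sigma) => /=.
  have G2 : 0 < 2 * gamma `^ B by rewrite mulr_gt0.
  by rewrite divr_gt0 //= mulr_gt0.
near=> t.
have tB : - B <= t by near: t; apply: nbhs_pinfty_ge; exact: num_real.
have t0 : 0 < gamma `^ (- t) by exact: powR_gt0.
have fin0 : 0 <= fine (normal_prob d sigma (A t)) by apply: fineP.
rewrite !ger0_norm ?(ltW t0) //; split.
  pose r := gamma `^ (- t - B).
  have r0 : 0 < r by exact: powR_gt0.
  have r1 : r <= 1.
    by rewrite -(powRr0 gamma); apply: ler_powR; [exact: ltW|lra].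
  have -> : c / (2 * gamma `^ B) * gamma `^ (- t) = (r - r / 2) * c.
    by rewrite /r gD [gamma `^ (- B)]powRN; field; rewrite gt_eqF.
  apply: fineP => //; apply: (normal_prob_ge s0) => //; first by lra.
    by move=> z /=; rewrite in_itv /= => /andP[z1 z2]; apply: hlow => //; lra.
  move=> z /andP[z1 z2]; apply: le_trans (ler_normB _ _) _.
  by rewrite lerD2r gtr0_norm; lra.
have -> : 2 * gamma `^ B * normal_peak sigma * gamma `^ (- t) =
    (gamma `^ (B - t) - - gamma `^ (B - t)) * normal_peak sigma.
  by rewrite gD; ring.
have b0 : 0 < gamma `^ (B - t) by exact: powR_gt0.
apply/(fineP' (mA t))/(@normal_prob_le _ d _ s0 (A t) (- gamma `^ (B - t))).
- exact: mA.
- lra.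
- by move=> z /hup; rewrite ler_norml /= in_itv.
Unshelve. all: by end_near. Qed.

(** The lower bound comes from the mass of [[r, r + 1]] with
    [r = gamma ^ (t + B)], the upper bound from [normal_tail_le].  Both are
    Gaussian expressions in [gamma ^ t], and their prefactors are absorbed by
    changing the constants in the exponent. *)
Lemma normal_tail_exp_Theta (A : R -> set R) :
  (forall t, measurable (A t)) ->
  (\forall t \near +oo, forall z, A t z -> gamma `^ (t - B) <= `|z|) ->
  (forall t z, gamma `^ (t + B) <= z -> A t z) ->
  exp_Theta_opp (fun t => fine (normal_prob d sigma (A t)))
    (fun t => gamma `^ (2 * t)).
Proof.
move=> mA hup hlow.
pose G := gamma `^ B.
have G0 : 0 < G by exact: powR_gt0.
have pk := normal_peak_gt0 s0.
have Gs : 0 < G ^+ 2 * sigma ^+ 2 by rewrite mulr_gt0 // exprn_gt0.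
(* With [u = gamma ^ t], the tail is at most
   [sqrt 2 * exp (- 2 c2 u ^ 2)] and [c2 u ^ 2] absorbs [sqrt 2]; the mass of
   [[r, r + 1]] is at least [peak * exp (- c1 u ^ 2)] and [u ^ 2] absorbs
   [peak].  The summand [c2] in the first constant ensures the required
   order of the two constants. *)
pose c2 := (32 * (G ^+ 2 * sigma ^+ 2))^-1.
have c20 : 0 < c2 by rewrite invr_gt0 mulr_gt0.
pose c1 := 2 * G ^+ 2 / sigma ^+ 2.
have c10 : 0 < c1 by rewrite divr_gt0 // mulr_gt0 // exprn_gt0.
exists (c1 + 1 + c2), c2; split=> //; first by lra.
near=> t.
have u1 : 1 <= gamma `^ t by near: t; exact: powR_near_pinfty.
have ud : (1 + `|d|) / G <= gamma `^ t by near: t; exact: powR_near_pinfty.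
have ud' : 2 * `|d| * G <= gamma `^ t by near: t; exact: powR_near_pinfty.
have up : `|ln (normal_peak sigma)| <= gamma `^ t.
  by near: t; exact: powR_near_pinfty.
have uc : c2^-1 <= gamma `^ t by near: t; exact: powR_near_pinfty.
have far : forall z, A t z -> gamma `^ (t - B) <= `|z| by near: t.
have u0 : 0 < gamma `^ t by exact: powR_gt0.
have tB : gamma `^ (t - B) = gamma `^ t / G by rewrite gD [gamma `^ (- B)]powRN.
have -> : gamma `^ (2 * t) = gamma `^ t ^+ 2.
  by rewrite mulr_natl mulr2n gD expr2.
have tG : gamma `^ (t + B) = gamma `^ t * G by rewrite gD.
move: u1 ud ud' up uc u0 tB tG; set u := gamma `^ t => u1 ud ud' up uc u0 tB tG.
have uu : u <= u ^+ 2 by rewrite expr2 ler_peMl // ltW.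
apply/andP; split.
  pose r := gamma `^ (t + B).
  have rE : r = u * G by [].
  have r1 : 1 + `|d| <= r by rewrite rE -ler_pdivrMr.
  have low : (((r + 1 - r) * (normal_peak sigma *
      expR (- (2 * r) ^+ 2 / (sigma ^+ 2 *+ 2))))%:E <=
      normal_prob d sigma (A t))%E.
    apply: (normal_prob_ge s0) => //; first by lra.
      move=> z /=; rewrite in_itv /= => /andP[z1 z2]; exact: hlow.
    move=> z /andP[z1 z2]; apply: le_trans (ler_normB _ _) _.
    by rewrite gtr0_norm; have := normr_ge0 d; lra.
  apply: le_trans (fineP (mA t) low).
  rewrite (addrC r) addrK mul1r -[normal_peak sigma]lnK ?posrE //.
  rewrite -expRD ler_expR.
  have -> : - (2 * r) ^+ 2 / (sigma ^+ 2 *+ 2) = - c1 * u ^+ 2.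
    by rewrite rE /c1; field.
  have := ler_norm (- ln (normal_peak sigma)); rewrite normrN => h.
  have h2 : 0 <= c2 * u ^+ 2 by rewrite mulr_ge0 ?sqr_ge0 // ltW.
  lra.
have dr : 2 * `|d| <= u / G by rewrite ler_pdivlMr.
have up_ : (normal_prob d sigma (A t) <= (Num.sqrt 2 *
    expR (- (u / G - `|d|) ^+ 2 / (sigma ^+ 2 *+ 4)))%:E)%E.
  apply: (normal_tail_le s0) => //; first by have := normr_ge0 d; lra.
  by move=> z; rewrite -tB; exact: far.
apply: le_trans (fineP' (mA t) up_) _.
have sq2 : Num.sqrt 2 <= expR (c2 * u ^+ 2).
  apply: (@le_trans _ _ 2).
    by rewrite -[leRHS]ger0_norm // -sqrtr_sqr ler_wsqrtr //; lra.
  apply: le_trans (expR_ge1Dx _).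
  have : 1 <= c2 * u ^+ 2 by rewrite -ler_pdivrMl // mulr1 (le_trans uc).
  lra.
have ex : - (u / G - `|d|) ^+ 2 / (sigma ^+ 2 *+ 4) <= - (2 * c2) * u ^+ 2.
  have -> : - (2 * c2) * u ^+ 2 = - (u / G / 2) ^+ 2 / (sigma ^+ 2 *+ 4).
    by rewrite /c2; field; rewrite s0 gt_eqF.
  rewrite ler_pM2r ?invr_gt0 ?mulrn_wgt0 // lerN2.
  by rewrite lerXn2r ?nnegrE //; have := normr_ge0 d; lra.
apply: le_trans (ler_pM _ _ sq2 (_ : _ <= expR (- (2 * c2) * u ^+ 2))) _.
- exact: sqrtr_ge0.
- exact: expR_ge0.
- by rewrite ler_expR.
by rewrite -expRD ler_expR; lra.
Unshelve. all: by end_near. Qed.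

End gaussian_asymptotics.

(** * The discretized height *)

Lemma log_base_norm_le (R : realType) (gamma z u : R) : 1 < gamma -> z != 0 ->
  (log_base gamma `|z| <= u) = (`|z| <= gamma `^ u).
Proof.
move=> g1 z0; have g0 : 0 < gamma by exact: lt_trans g1.
have lg0 : 0 < ln gamma by rewrite ln_gt0.
rewrite /log_base ler_pdivrMr // -ln_powR ler_ln // posrE ?powR_gt0 //.
by rewrite normr_gt0.
Qed.

Lemma log_base_norm_ge (R : realType) (gamma z u : R) : 1 < gamma -> z != 0 ->
  (u <= log_base gamma `|z|) = (gamma `^ u <= `|z|).
Proof.
move=> g1 z0; have g0 : 0 < gamma by exact: lt_trans g1.
have lg0 : 0 < ln gamma by rewrite ln_gt0.
rewrite /log_base ler_pdivlMr // -ln_powR ler_ln // posrE ?powR_gt0 //.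
by rewrite normr_gt0.
Qed.

Section discretized_height.
Variables (R : realType) (f : R -> R) (m : nat) (beta gamma x y : R).
Hypothesis hf : majority_type f m beta gamma.
Hypotheses (hx : 0 <= x < 1) (hy : 0 <= y < 1).

Definition floor_height (z : R) : R :=
  (Num.floor (majority_h f m gamma (x - log_base gamma `|z|) + y))%:~R.

Lemma measurable_floor_height : measurable_fun setT floor_height.
Proof.
have -> : floor_height =
  (fun v : R => (Num.floor (majority_h f m gamma v + y))%:~R) \o
  (fun z => x - log_base gamma `|z|) by [].
apply: measurableT_comp.
  apply: nondecreasing_measurable => // v w vw.
  rewrite ler_int; apply: le_floor.
  by rewrite lerD2r (majority_h_nondecreasing hf).
apply: measurable_funB => //; apply: measurable_funM => //.
by apply: measurableT_comp; [exact: measurable_ln|exact: normr_measurable].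
Qed.

Lemma floor_height_near_log : exists B : R,
  forall z, `|floor_height z + log_base gamma `|z| | <= B.
Proof.
have [B hB] := majority_h_near_id hf.
exists (B + 2) => z; rewrite /floor_height.
set l := log_base gamma `|z|.
have := hB (x - l); move: (majority_h f m gamma (x - l)) => v.
have /andP[v1 v2] := floor_itv (v + y); rewrite intrD in v2.
rewrite !ler_norml => /andP[h1 h2].
move: hx hy v1 v2 => /andP[? ?] /andP[? ?]; move: (_%:~R) => k ? ?.
by apply/andP; split; lra.
Qed.

End discretized_height.

Theorem lemma1p6 (R : realType) (d : R) (f : R -> R) (m : nat) (beta gamma : R)
    (hf : majority_type f m beta gamma)
    (dT : measure_display) (T : measurableType dT) (P : probability T R)
    (Z : {RV P >-> R})
    (hZ : forall A : set R, measurable A ->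
      distribution P Z A =
        normal_prob d (Num.sqrt (1 / (4 * (gamma ^+ 2 - 1)))) A)
    (x y : R) (hx : 0 <= x < 1) (hy : 0 <= y < 1)
    (dT' : measure_display) (T' : measurableType dT') (Q : probability T' R)
    (H : {RV Q >-> R})
    (hH : forall A : set R, measurable A ->
      distribution Q H A =
        P [set w | A (Num.floor (majority_h f m gamma
                         (x - log_base gamma `|Z w|) + y))%:~R]) :
  (fun t : R => fine (Q [set w | t <= H w]))
    \is 'Theta_(pinfty_nbhs R) (fun t : R => gamma `^ (- t)) /\
  exp_Theta_opp (fun t : R => fine (Q [set w | H w <= - t]))
    (fun t : R => gamma `^ (2 * t)).
Proof.
set sigma := Num.sqrt _ in hZ.
have g1 := majority_gamma_gt1 hf.
have s0 : sigma != 0.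
  rewrite gt_eqF // sqrtr_gt0 divr_gt0 // mulr_gt0 // subr_gt0.
  by rewrite exprn_egt1.
pose k := floor_height f m gamma x y.
have mk (A : set R) : measurable A -> measurable (k @^-1` A).
  move=> mA; rewrite -[X in measurable X]setTI.
  exact: (measurable_floor_height x y hf).
have law (A : set R) : measurable A ->
    Q (H @^-1` A) = normal_prob d sigma (k @^-1` A).
  by move=> mA; rewrite -(hZ _ (mk _ mA)); exact: hH.
have [B hB] := floor_height_near_log hf hx hy.
have mge t : measurable (`[t, +oo[%classic : set R) by [].
have mle t : measurable (`]-oo, - t]%classic : set R) by [].
split.
  have -> : (fun t : R => fine (Q [set w | t <= H w])) =
      (fun t => fine (normal_prob d sigma (k @^-1` `[t, +oo[))).
    apply/funext => t; rewrite -law //; congr (fine (Q _)).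
    by apply/seteqP; split => w /=; rewrite in_itv /= andbT.
  apply: (@normal_ball_Theta _ d sigma gamma B) => //.
  - by move=> t; exact: mk.
  - move=> t z /=; rewrite in_itv /= andbT => tk.
    (* [log_base gamma 0] is 0, so the point 0 is treated apart. *)
    have [->|z0] := eqVneq z 0; first by rewrite normr0 powR_ge0.
    rewrite -log_base_norm_le //.
    by have := hB z; rewrite -/(k z) ler_norml => /andP[_]; lra.
  - move=> t z z0 zt /=; rewrite in_itv /= andbT.
    have : log_base gamma `|z| <= - t - B.
      by rewrite log_base_norm_le ?gt_eqF // gtr0_norm.
    by have := hB z; rewrite -/(k z) ler_norml => /andP[+ _]; lra.
have -> : (fun t : R => fine (Q [set w | H w <= - t])) =
    (fun t => fine (normal_prob d sigma (k @^-1` `]-oo, - t]))).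
  by apply/funext => t; rewrite -law.
apply: (@normal_tail_exp_Theta _ d sigma gamma B) => //.
- by move=> t; exact: mk.
- near=> t => z /=; rewrite in_itv /= => kt.
  have tk0 : - k 0 < t by near: t; apply: nbhs_pinfty_gt; exact: num_real.
  (* The value at 0 is a fixed number, which [- t] eventually undercuts. *)
  have [z0|z0] := eqVneq z 0; first by move: kt; rewrite z0; lra.
  rewrite -log_base_norm_ge //.
  by have := hB z; rewrite -/(k z) ler_norml => /andP[+ _]; lra.
- move=> t z tz /=; rewrite in_itv /=.
  have z0 : 0 < z by apply: lt_le_trans tz; rewrite powR_gt0 // (lt_trans _ g1).
  have : t + B <= log_base gamma `|z|.
    by rewrite log_base_norm_ge ?gt_eqF // gtr0_norm.
  by have := hB z; rewrite -/(k z) ler_norml => /andP[_]; lra.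
Unshelve. all: by end_near. Qed.
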